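(* Let $n$ be even and $n\geq 8$. Suppose that $\mathcal{C}$ is an $(n,m,q)$ wide-sense $2$-frameproof code. Then $$m\leq\binom{n}{\frac{n}{2}-1}-\frac{n}{2}+1.$$
   Context: Let $Q$ be a finite alphabet of size $q$. A code $\mathcal{C}\subseteq Q^n$ with $|\mathcal{C}|=m$ is called an $(n,m,q)$ code. For a (nonempty) finite set $X=\{x^1,\ldots,x^t\}\subseteq Q^n$, where $x^j_i$ is the $i$-th component of $x^j$, let $U(X)=\{i\in\{1,\ldots,n\}: x^1_i=\cdots=x^t_i\}$ be the set of undetectable positions for $X$, and define the wide-sense descendant set $$\operatorname{wdesc}(X)=\{y\in Q^n: y_i=x^1_i \text{ for all } i\in U(X)\}.$$ A code $\mathcal{C}\subseteq Q^n$ is a wide-sense $t$-frameproof code ($t$-wFP code) if $\operatorname{wdesc}(X)\cap\mathcal{C}=X$ for all (nonempty) $X\subseteq\mathcal{C}$ with $|X|\le t$. *)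

(* Defs.v *)
From mathcomp Require Import all_boot.
Set Implicit Arguments.
Unset Strict Implicit.
Unset Printing Implicit Defensive.

Section Codes.

Variables (n : nat) (Q : finType).

Notation word := {ffun 'I_n -> Q}.

Implicit Types (X C : {set word}).

Definition is_code (m q : nat) C : Prop := #|Q| = q /\ #|C| = m.

Definition undetectable X : {set 'I_n} :=
  [set i | [forall x in X, forall y in X, (x : word) i == (y : word) i]].

(* At an undetectable position all words of X agree, so for nonempty X it makes
   no difference whether y is compared with one of them or with all of them. *)
Definition wdesc X : {set word} :=
  [set y : word |
    [forall i in undetectable X, forall x in X, y i == (x : word) i]].

Definition wide_frameproof (t : nat) C : Prop :=
  forall X, X != set0 -> X \subset C -> #|X| <= t -> wdesc X :&: C = X.

End Codes.

(* Main.v *)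
Require Import Defs.
From mathcomp Require Import all_boot all_algebra zify.

(** Let [n = 2k].  Around a word [x] of the code, put for every other word [y]
    the set of positions where [y] differs from [x].  Being wide-sense
    2-frameproof says that among any three words [x], [y], [z] there is a
    position where [x] and [y] agree and [z] does not; playing this with the
    three choices of [z] shows that the difference sets around [x] are distinct
    ([differ_sub_inj]), form an antichain, and pairwise meet.

    Milner bounds an intersecting antichain on [2k] points by
    ['C(2k, k + 1) = 'C(2k, k - 1)].  His proof pushes the members of size at
    most [k] up to level [k + 1] and the larger ones down to the same level,
    and it never loses sets.  The theorem asks for [k] more than that, and the
    pushing supplies it as soon as one set has to cross between levels other
    than the two middle ones: a nonempty family on a level below the middle has
    an upper shadow larger than itself by at least the number of free points
    minus one ([upshadow_gain]).  So [milner_gain] settles every code with two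
    words at distance below [k] or above [k + 1].

    Otherwise all difference sets around [x] have size [k] or [k + 1].  If two
    of them, those of [y] and [z], cover all positions, then they overlap in
    at most two positions, and [y] and [z] agree only inside the overlap
    ([differ_cover]); their distance is at least [n - 2 > k + 1], and
    [milner_gain] applies around [y].  If no two cover all positions, replacing
    the [k + 1]-sets by their lower shadow yields a family of [k]-sets without
    complementary pairs, so there are at most ['C(2k, k) / 2] of them
    ([middle_levels]), far below the bound.

    The delicate step in Milner's bound is from level [k] to level [k + 1],
    where double counting is too weak: it needs that a family of [k]-sets
    without complementary pairs has an upper shadow at least as large as itself
    ([upshadow_ge_noncompl]).  This is linear algebra: a weight on [k]-sets that
    sums to zero below every [k + 1]-set takes, up to sign, the same value at a
    set and at its complement ([kernel_compl]), so one supported on such a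
    family vanishes; the inclusion matrix between the family and its shadow
    therefore has independent rows. *)

Set Implicit Arguments.
Unset Strict Implicit.
Unset Printing Implicit Defensive.
Import GRing.Theory Num.Theory.

(** * Shadows in intervals of the subset lattice *)

Definition upshadow (T : finType) (V : {set T}) (F : {set {set T}}) :=
  [set B | [exists A in F, exists v in V :\: A, B == v |: A]].

Lemma upshadowP (T : finType) (V B : {set T}) (F : {set {set T}}) :
  reflect (exists A v, [/\ A \in F, v \in V :\: A & B = v |: A])
          (B \in upshadow V F).
Proof.
rewrite inE; apply: (iffP exists_inP) => [[A AF /exists_inP[v vA /eqP->]]|].
  by exists A, v.
by case=> A [v [AF vA ->]]; exists A => //; apply/exists_inP; exists v.
Qed.

(** The lower bound [K] is carried along so that an element can be fixed as a
    member of every set ([x |: K]) or banned from every set ([V :\ x]) with the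
    family staying inside one subset lattice. *)
Definition in_layer (T : finType) (K V : {set T}) (r u : nat)
    (F : {set {set T}}) :=
  forall A, A \in F ->
    [/\ K \subset A, A \subset V, #|A :\: K| = r & #|V :\: A| = u].

Lemma card_superset1 (T : finType) (A B : {set T}) :
  A \subset B -> #|B| = #|A|.+1 -> exists2 v, v \in B :\: A & B = v |: A.
Proof.
move=> AB cB.
have /cards1P[v vE]: #|B :\: A| == 1 by rewrite cardsDS // cB subSn // subnn.
exists v; first by rewrite vE set11.
by rewrite -vE setUC -{1}(setID B A) (setIidPr AB).
Qed.

(** Double counting of the inclusions between the family and its shadow: each
    member lies below [u] sets of the shadow, and a set of the shadow lies above
    at most [r + 1] members, since the removed element avoids [K]. *)
Lemma local_LYM (T : finType) (K V : {set T}) r u (F : {set {set T}}) :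
  in_layer K V r u F -> #|F| * u <= #|upshadow V F| * r.+1.
Proof.
move=> lF; pose e (A B : {set T}) : nat := (A \subset B : bool).
have: \sum_(A in F) \sum_(B in upshadow V F) e A B =
      \sum_(B in upshadow V F) \sum_(A in F) e A B by exact: exchange_big.
have lo : #|F| * u <= \sum_(A in F) \sum_(B in upshadow V F) e A B.
  rewrite -sum_nat_const; apply: leq_sum => A AF.
  have [_ _ _ <-] := lF A AF.
  rewrite -(@card_in_imset _ _ (fun v => v |: A)); last first.
    move=> v w /setDP[_ vA] /setDP[_ wA] /setP/(_ v).
    by rewrite !inE eqxx (negPf vA) !orbF => /esym/eqP.
  rewrite -sum1_card [X in _ <= X](bigID (mem [set v |: A | v in V :\: A])) /=.
  apply: leq_trans _ (leq_addr _ _).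
  rewrite [X in X <= _](eq_bigl (fun B =>
      (B \in upshadow V F) && (B \in [set v |: A | v in V :\: A]))).
    by apply: leq_sum => B /andP[_ /imsetP[v _ ->]]; rewrite /e subsetUr.
  move=> B; case: imsetP => [[v vA ->]|]; rewrite ?andbF // andbT.
  by apply/esym/upshadowP; exists A, v.
have hi : \sum_(B in upshadow V F) \sum_(A in F) e A B <= #|upshadow V F| * r.+1.
  rewrite -sum_nat_const; apply: leq_sum => B /upshadowP[A [v [AF vA BE]]].
  have [KA AV cA _] := lF A AF.
  have/setDP[vV vnA] := vA.
  have cK : #|A| = #|K| + r by rewrite -cA cardsDS // subnKC // subset_leq_card.
  have cB : #|B| = #|A|.+1 by rewrite BE cardsU1 vnA.
  have KB : K \subset B by rewrite BE (subset_trans KA) ?subsetUr.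
  have -> : r.+1 = #|B :\: K| by rewrite cardsDS // cB cK; lia.
  rewrite -big_mkcondr /= sum1_card.
  apply: leq_trans (leq_imset_card (fun v => B :\ v) _).
  apply/subset_leq_card/subsetP => A'; rewrite unfold_in => /andP[A'F A'B].
  have [KA' _ cA' _] := lF A' A'F.
  have cA'K : #|A'| = #|K| + r by rewrite -cA' cardsDS // subnKC // subset_leq_card.
  have [|w /setDP[wB wA'] BE'] := card_superset1 A'B; first by rewrite cB cK cA'K.
  apply/imsetP; exists w; last by rewrite BE' setU1K.
  by rewrite inE wB andbT; apply: contra wA' => /(subsetP KA').
by move=> E; apply: leq_trans lo _; rewrite E.
Qed.

Lemma upshadow_ge (T : finType) (K V : {set T}) r u (F : {set {set T}}) :
  in_layer K V r u F -> r < u -> #|F| <= #|upshadow V F|.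
Proof.
move=> /local_LYM H ru; rewrite -(leq_pmul2r (ltn0Sn r)).
by apply: leq_trans H; rewrite leq_mul2l ru orbT.
Qed.

(** Induction on [r], with [u] constant.  Choose [x] in some member.  The
    members containing [x] are nonempty and live in the layer above [x |: K], so
    they already gain [u - 1] by induction; the members avoiding [x] are shaded
    within [V :\ x], where double counting still shows no loss, because one
    spare unit is available in [r + 1 < u].  The two shadows are told apart by
    [x]. *)
Lemma upshadow_gain (T : finType) (K V : {set T}) r u (F : {set {set T}}) :
  in_layer K V r u F -> r.+1 < u -> F != set0 ->
  #|F| + u.-1 <= #|upshadow V F|.
Proof.
elim: r K F => [|r IH] K F lF ru /set0Pn[A0 A0F].
  have [KA0 _ /eqP c0 u0] := lF _ A0F.
  have F1 : #|F| <= 1.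
    apply/card_le1P => A AF B; rewrite inE.
    have AK A' : A' \in F -> A' = K.
      move=> /lF[KA' _ /eqP]; rewrite cards_eq0 setD_eq0 => A'K _.
      by apply/eqP; rewrite eqEsubset A'K.
    by apply/idP/eqP => [/AK->|->//]; rewrite (AK A).
  have := local_LYM lF; rewrite muln1.
  have: 0 < #|F| by apply/card_gt0P; exists A0.
  move: F1; case: #|F| => [|[|]] //= _ _; lia.
have [KA0 A0V c0 u0] := lF _ A0F.
have /card_gt0P[x /setDP[xA0 xK]] : 0 < #|A0 :\: K| by rewrite c0.
pose F1 := [set A in F | x \in A]; pose F0 := [set A in F | x \notin A].
have cF : #|F| = #|F1| + #|F0|.
  rewrite -(cardsID [set A : {set T} | x \in A] F); congr (_ + _).
    by apply: eq_card => A; rewrite !inE.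
  by apply: eq_card => A; rewrite !inE andbC.
have l1 : in_layer (x |: K) V r u F1.
  move=> A; rewrite inE => /andP[/lF[KA AV cA uA] xA]; split=> //.
    by rewrite subUset sub1set xA.
  by have := cardsD1 x (A :\: K); rewrite cA inE xK xA setUC setDDl => -[].
have l0 : in_layer K (V :\ x) r.+1 u.-1 F0.
  move=> A; rewrite inE => /andP[/lF[KA AV cA uA] xA]; split=> //.
    by rewrite subsetD1 AV.
  have xV : x \in V by apply: (subsetP A0V).
  rewrite -uA (cardsD1 x (V :\: A)) inE xA xV /=.
  by apply: eq_card => y; rewrite !inE andbCA.
have h1 : #|F1| + u.-1 <= #|upshadow V F1|.
  apply: (IH _ _ l1); first lia.
  by apply/set0Pn; exists A0; rewrite inE A0F.
have h0 : #|F0| <= #|upshadow (V :\ x) F0| by apply: (upshadow_ge l0); lia.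
suff: #|upshadow V F1| + #|upshadow (V :\ x) F0| <= #|upshadow V F| by lia.
rewrite -cardsUI [X in _ + X](_ : _ = 0) ?addn0.
  apply/subset_leq_card/subsetP => B; rewrite inE => /orP[] /upshadowP[A [v []]].
    by rewrite inE => /andP[AF _] vA ->; apply/upshadowP; exists A, v.
  move=> /setIdP[AF _] /setDP[/setD1P[_ vV] vA] ->; apply/upshadowP; exists A, v.
  by rewrite inE vA.
apply: eq_card0 => B; rewrite in_setI; apply/negP => /andP[].
move=> /upshadowP[A [v [AF1 _ ->]]] /upshadowP[A' [w [A'F0 ww]]] /setP/(_ x).
move: AF1 A'F0 ww; rewrite !inE => /andP[_ xA] /andP[_ xA'] /and3P[_ wx _].
by rewrite xA (negPf xA') orbT orbF eq_sym (negPf wx).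
Qed.

(** * Families without complementary pairs in the middle level *)

Local Open Scope ring_scope.

(** A weight [f] on sets that vanishes off level [k] is in the kernel of the
    inclusion matrix between levels [k] and [k + 1] when its [interval_sum] from
    [set0] to every [k + 1]-set is zero. *)
Definition interval_sum (T : finType) (f : {set T} -> rat) (S B : {set T}) :=
  \sum_(A : {set T} | (S \subset A) && (A \subset B)) f A.

Lemma interval_sumU1 (T : finType) (f : {set T} -> rat) (x : T) (S B : {set T}) :
  interval_sum f S B = interval_sum f (x |: S) B + interval_sum f S (B :\ x).
Proof.
rewrite /interval_sum (bigID (fun A : {set T} => x \in A)) /=; congr (_ + _).
  apply: eq_bigl => A; rewrite subUset sub1set.
  by case: (x \in A); rewrite ?andbF ?andbT.
by apply: eq_bigl => A; rewrite subsetD1 andbA.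
Qed.

(** Summing the sums over [B :\ x] for [x] in [B] counts each [k]-subset of [B]
    exactly [#|B| - k] times, and this number is invertible in characteristic
    zero. *)
Lemma interval_sum0_eq0 (T : finType) (k : nat) (f : {set T} -> rat) :
  (forall A : {set T}, #|A| != k -> f A = 0) ->
  (forall B : {set T}, #|B| = k.+1 -> interval_sum f set0 B = 0) ->
  forall B : {set T}, (k < #|B|)%N -> interval_sum f set0 B = 0.
Proof.
move=> fk f0 B; have [n] := ubnP #|B|; elim: n B => // n IH B nB kB.
have [/f0//|kB'] := eqVneq #|B| k.+1.
have E: \sum_(x in B) interval_sum f set0 (B :\ x) =
        interval_sum f set0 B *+ (#|B| - k).
  rewrite /interval_sum -sumrMnl.
  rewrite (exchange_big_dep (fun A : {set T} => A \subset B)) /=; last first.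
    by move=> x A _ /andP[_]; rewrite subsetD1 => /andP[].
  rewrite [RHS](eq_bigl (fun A : {set T} => A \subset B)); last first.
    by move=> A; rewrite sub0set.
  apply: eq_bigr => A AB.
  rewrite sumr_const; have [cA|/fk->] := eqVneq #|A| k; last by rewrite !mul0rn.
  congr (_ *+ _); rewrite -cA -cardsDS //; apply: eq_card => x.
  by rewrite !inE unfold_in /= sub0set subsetD1 AB andbC.
have /eqP: interval_sum f set0 B *+ (#|B| - k) = 0.
  rewrite -E big1 // => x xB; have := cardsD1 x B; rewrite xB => cB.
  apply: IH; lia.
by rewrite mulrn_eq0 subn_eq0 leqNgt kB /= => /eqP.
Qed.

Lemma interval_sum_eq0 (T : finType) (k : nat) (f : {set T} -> rat) :
  (forall A : {set T}, #|A| != k -> f A = 0) ->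
  (forall B : {set T}, #|B| = k.+1 -> interval_sum f set0 B = 0) ->
  forall S B : {set T}, (k + #|S| < #|B|)%N -> interval_sum f S B = 0.
Proof.
move=> fk f0 S; have [n] := ubnP #|S|; elim: n S => // n IH S nS B.
have [->|/set0Pn[x xS]] := eqVneq S set0.
  by rewrite cards0 addn0; apply: interval_sum0_eq0.
have := cardsD1 x S; rewrite xS => cS lt.
have cB := cardsD1 x B.
have := interval_sumU1 f x (S :\ x) B; rewrite setD1K //.
rewrite !(IH (S :\ x)) ?addr0; try by case: (x \in B) cB; lia.
by move=> <-.
Qed.

(** On the boundary [#|B| = k + #|S|], moving an element [x] of [S] from
    required to forbidden only flips the sign: in [interval_sumU1] the sum that
    leaves [x] free is zero by [interval_sum_eq0].  Moving all of [S] leads from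
    the interval between [S] and [B] to the one between [set0] and [B :\: S]. *)
Lemma interval_sum_compl (T : finType) (k : nat) (f : {set T} -> rat) :
  (forall A : {set T}, #|A| != k -> f A = 0) ->
  (forall B : {set T}, #|B| = k.+1 -> interval_sum f set0 B = 0) ->
  forall S B : {set T}, #|B| = (k + #|S|)%N -> S \subset B ->
  interval_sum f set0 (B :\: S) = 0 -> interval_sum f S B = 0.
Proof.
move=> fk f0 S; have [n] := ubnP #|S|; elim: n S => // n IH S nS B.
have [->|/set0Pn[x xS]] := eqVneq S set0; first by rewrite setD0.
have := cardsD1 x S; rewrite xS => cS cBS SB.
have := cardsD1 x B; rewrite (subsetP SB x xS) => cB.
have := interval_sumU1 f x (S :\ x) B; rewrite setD1K //.
rewrite (@interval_sum_eq0 _ k) //; last lia.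
move=> E E0; have := E; rewrite [X in _ + X]IH ?addr0 //; try lia.
- by rewrite setSD.
- rewrite -[RHS]E0; congr (interval_sum _ _ _); apply/setP => y; rewrite !inE.
  by have [->|] := eqVneq y x; rewrite ?xS.
Qed.

(** Both values are interval sums: [f A] from [A] to [setT], and [f (~: A)] from
    [set0] to [~: A], so [interval_sum_compl] links them.  They agree up to sign;
    only the vanishing is recorded. *)
Lemma kernel_compl (T : finType) (k : nat) (f : {set T} -> rat) :
  #|T| = k.*2 ->
  (forall A : {set T}, #|A| != k -> f A = 0) ->
  (forall B : {set T}, #|B| = k.+1 -> interval_sum f set0 B = 0) ->
  forall A : {set T}, f (~: A) = 0 -> f A = 0.
Proof.
move=> cT fk f0 A fA; have [cA|/fk//] := eqVneq #|A| k.
have cAC : #|~: A| = k by have := cardsC A; lia.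
have top : interval_sum f A setT = f A.
  rewrite /interval_sum (bigD1 A) ?subxx ?subsetT //= big1 ?addr0 //.
  move=> A' /andP[/andP[AA' _] nA]; apply: fk; apply: contra nA => /eqP cA'.
  by rewrite eq_sym eqEcard AA' cA' cA /=.
have bot : interval_sum f set0 (~: A) = f (~: A).
  rewrite /interval_sum (bigD1 (~: A)) ?subxx ?sub0set //= big1 ?addr0 //.
  move=> A' /andP[/andP[_ AA'] nA]; apply: fk; apply: contra nA => /eqP cA'.
  by rewrite eqEcard AA' cA' cAC /=.
rewrite -top; apply: (@interval_sum_compl _ k); rewrite ?subsetT ?setTD ?bot //.
by rewrite cardsT; lia.
Qed.

Local Close Scope ring_scope.

(** The rows of the inclusion matrix between [F] and its shadow are independent:
    a relation among them, read as a weight on [k]-sets, is in the kernel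
    treated above and vanishes off [F], hence at every complement of a member,
    hence at every member. *)
Lemma upshadow_ge_noncompl (T : finType) (k : nat) (F : {set {set T}}) :
  #|T| = k.*2 -> (forall A, A \in F -> #|A| = k) ->
  (forall A, A \in F -> ~: A \notin F) -> #|F| <= #|upshadow setT F|.
Proof.
move=> cT Fk Fnc; set G := upshadow setT F.
pose M := (\matrix_(i < #|F|, j < #|G|)
  ((enum_val i : {set T}) \subset (enum_val j : {set T}))%:R)%R : 'M[rat]_(_, _).
suff: row_free M by rewrite /row_free => /eqP <-; apply: rank_leq_col.
apply: inj_row_free => u uM.
pose f (A : {set T}) := (\sum_(i < #|F| | enum_val i == A) u ord0 i)%R.
have fval i : f (enum_val i) = u ord0 i.
  by rewrite /f (big_pred1 i) // => j /=; rewrite (inj_eq enum_val_inj).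
have fF A : A \notin F -> f A = 0%R.
  move=> AF; apply: big_pred0 => i.
  by apply: contraNF AF => /eqP<-; apply: enum_valP.
have fk (A : {set T}) : #|A| != k -> f A = 0%R.
  by move=> cA; apply: fF; apply: contra cA => /Fk->.
have f0 (B : {set T}) : #|B| = k.+1 -> interval_sum f set0 B = 0%R.
  move=> cB.
  have -> : interval_sum f set0 B =
      (\sum_(i < #|F|) u ord0 i * (enum_val i \subset B)%:R)%R.
    rewrite /interval_sum /f (exchange_big_dep xpredT) //=; apply: eq_bigr => i _.
    have [iB|iB] := boolP (enum_val i \subset B).
      rewrite mulr1 (big_pred1 (enum_val i)) // => A /=; rewrite sub0set /=.
      by rewrite eq_sym; case: eqP => [->|]; rewrite ?andbF ?iB.
    rewrite mulr0 big_pred0 // => A; rewrite sub0set /=.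
    by apply: contraNF iB => /andP[AB /eqP->].
  have [BG|BG] := boolP (B \in G).
    have /rowP/(_ (enum_rank_in BG B)) := uM.
    rewrite mxE [RHS]mxE => E; rewrite -[RHS]E; apply: eq_bigr => i _.
    by rewrite mxE enum_rankK_in.
  (* A [k + 1]-set outside the shadow contains no member of [F]. *)
  apply: big1 => i _; have [iB|] := boolP (_ \subset B); last by rewrite mulr0.
  case/negP: BG; have [|v /setDP[_ vA] BE] := card_superset1 iB.
    by rewrite cB (Fk _ (enum_valP i)).
  by apply/upshadowP; exists (enum_val i), v; rewrite enum_valP inE vA inE.
apply/rowP => i; rewrite mxE -fval; apply: (kernel_compl cT fk f0).
by apply/fF/Fnc/enum_valP.
Qed.

(** * Intersecting antichains *)

Definition antichain (T : finType) (F : {set {set T}}) :=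
  forall A B, A \in F -> B \in F -> A \subset B -> A = B.

Definition intersecting (T : finType) (F : {set {set T}}) :=
  forall A B, A \in F -> B \in F -> A :&: B != set0.

Definition upset_level (T : finType) (F : {set {set T}}) (j : nat) :=
  [set B : {set T} | (#|B| == j) && [exists A in F, A \subset B]].

Lemma upset_levelP (T : finType) (F : {set {set T}}) (j : nat) (B : {set T}) :
  reflect (#|B| = j /\ exists2 A, A \in F & A \subset B) (B \in upset_level F j).
Proof.
rewrite inE; apply: (iffP andP) => -[].
  by move=> /eqP cB /exists_inP.
by move=> cB /exists_inP; rewrite cB.
Qed.

Lemma upset_level_in_layer (T : finType) (F : {set {set T}}) (j : nat) :
  in_layer set0 setT j (#|T| - j) (upset_level F j).
Proof.
move=> A /upset_levelP[cA _]; rewrite sub0set subsetT setD0 setTD cA; split=> //.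
by have := cardsC A; lia.
Qed.

(** Climbing one level picks up the members of size [j + 1], which are new: by
    the antichain property none of them lies above a smaller member. *)
Lemma upset_level_step (T : finType) (F : {set {set T}}) (j : nat) :
  antichain F ->
  #|upshadow setT (upset_level F j)| + #|[set A in F | #|A| == j.+1]|
    <= #|upset_level F j.+1|.
Proof.
move=> aF; rewrite -cardsUI [X in _ + X](_ : _ = 0) ?addn0.
  apply/subset_leq_card/subsetP => B; rewrite inE => /orP[].
    move=> /upshadowP[A [v [/upset_levelP[cA [A' A'F A'A]] /setDP[_ vA] ->]]].
    apply/upset_levelP; rewrite cardsU1 vA cA; split=> //; exists A' => //.
    by rewrite (subset_trans A'A) ?subsetUr.
  by rewrite inE => /andP[BF /eqP cB]; apply/upset_levelP; split=> //; exists B.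
apply: eq_card0 => B; rewrite in_setI; apply/negP => /andP[].
move=> /upshadowP[A [v [/upset_levelP[cA [A' A'F A'A]] /setDP[_ vA] BE]]].
rewrite inE => /andP[BF _].
have AB : A \subset B by rewrite BE subsetUr.
have EB := aF A' B A'F BF (subset_trans A'A AB).
by case/negP: vA; rewrite (subsetP A'A) // EB BE !inE eqxx.
Qed.

(** Below the middle no climbing step loses sets.  Once some smaller member has
    made the current level nonempty, the last step alone gains [#|T| - j]. *)
Lemma upset_level_ge (T : finType) (F : {set {set T}}) (j : nat) :
  antichain F -> j.*2 <= #|T| ->
  #|[set A in F | #|A| <= j]| <= #|upset_level F j| /\
  ((exists2 A, A \in F & #|A| < j) ->
   #|[set A in F | #|A| <= j]| + (#|T| - j) <= #|upset_level F j|).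
Proof.
move=> aF; elim: j => [|j IH] jT.
  split; last by case.
  apply/subset_leq_card/subsetP => A; rewrite inE leqn0 => /andP[AF /eqP cA].
  by apply/upset_levelP; split=> //; exists A.
have [|ge _] := IH; first lia.
have st := upset_level_step j aF.
have lay := @upset_level_in_layer T F j.
have cS : #|[set A in F | #|A| <= j.+1]| =
          #|[set A in F | #|A| <= j]| + #|[set A in F | #|A| == j.+1]|.
  rewrite -cardsUI [X in _ = _ + X](_ : _ = 0) ?addn0.
    apply: eq_card => A.
    by rewrite !inE -andb_orr [_ <= j.+1]leq_eqVlt orbC ltnS.
  apply: eq_card0 => A; rewrite !inE; apply/negP.
  by case/andP=> /andP[_ le] /andP[_ /eqP E]; rewrite E ltnn in le.
split.
  have jT' : j < #|T| - j by lia.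
  rewrite cS (leq_trans _ st) // leq_add2r.
  exact: leq_trans ge (upshadow_ge lay jT').
case=> A AF cA; rewrite cS.
suff: upset_level F j != set0.
  move=> U0; have j2 : j.+1 < #|T| - j by lia.
  rewrite (leq_trans _ st) // addnAC leq_add2r.
  rewrite (leq_trans _ (upshadow_gain lay j2 U0)) // leq_add //; lia.
have : 0 < #|upset_level F j|.
  by apply: leq_trans ge; apply/card_gt0P; exists A; rewrite inE AF.
by case/card_gt0P => B BU; apply/set0Pn; exists B.
Qed.

Definition co_family (T : finType) (F : {set {set T}}) := [set ~: A | A in F].

Lemma co_familyE (T : finType) (F : {set {set T}}) (A : {set T}) :
  (A \in co_family F) = (~: A \in F).
Proof.
apply/imsetP/idP => [[B BF ->]|AF]; first by rewrite setCK.
by exists (~: A); rewrite ?setCK.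
Qed.

Lemma card_co_family (T : finType) (F : {set {set T}}) : #|co_family F| = #|F|.
Proof. by apply/card_imset/setC_inj. Qed.

(** The members of size at most [k] are pushed up to [U] on level [k], the
    others down to level [k + 1]; taking complements turns the latter into a push
    up to [D] on level [k - 1].  [U] has no complementary pair, as two members
    below such a pair would be disjoint, so it moves up to level [k + 1] without
    loss.  There its shadow is disjoint from the pushed-down sets, because a set
    in both would lie between a small and a large member.  An extreme member
    makes one of the two pushes gain [k]. *)
Lemma milner_gain (T : finType) (k : nat) (F : {set {set T}}) :
  #|T| = k.*2 -> 0 < k -> antichain F -> intersecting F ->
  (exists2 A, A \in F & (#|A| < k) || (k.+1 < #|A|)) ->
  #|F| + k <= 'C(k.*2, k.+1).
Proof.
move=> cT k0 aF iF [A0 A0F sA0].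
have cC (A : {set T}) : #|~: A| = k.*2 - #|A| by have := cardsC A; lia.
have aF' : antichain (co_family F).
  move=> A B; rewrite !co_familyE => AF BF AB; apply: setC_inj.
  by apply/esym/aF => //; rewrite setCS.
have [|loge lo] := @upset_level_ge T F k aF; first by rewrite cT.
have [|hige hi] := @upset_level_ge T (co_family F) k.-1 aF'; first lia.
set U := upset_level F k in loge lo.
set D := upset_level (co_family F) k.-1 in hige hi.
have U_up : #|U| <= #|upshadow setT U|.
  apply: (upshadow_ge_noncompl cT) => A /upset_levelP[cA [B BF BA]] //.
  apply/negP => /upset_levelP[_ [B' B'F B'A]].
  case/negP: (iF _ _ BF B'F); rewrite setI_eq0 disjoints_subset.
  by rewrite (subset_trans BA) // -setCS setCK.
have UD : #|upshadow setT U| + #|co_family D| <= 'C(k.*2, k.+1).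
  rewrite -cardsUI [X in _ + X](_ : _ = 0) ?addn0.
    rewrite -cT -card_draws; apply/subset_leq_card/subsetP => B.
    rewrite in_setU => BU; rewrite inE; move: BU => /orP[/upshadowP|].
      by case=> A [v [/upset_levelP[cA _] /setDP[_ vA] ->]]; rewrite cardsU1 vA cA.
    by rewrite co_familyE => /upset_levelP[cB _]; have := cardsC B; lia.
  apply: eq_card0 => B; rewrite in_setI co_familyE; apply/negP => /andP[].
  move=> /upshadowP[A [v [/upset_levelP[cA [A1 A1F A1A]] vA BE]]].
  move=> /upset_levelP[cB [A2]]; rewrite co_familyE => A2F A2B.
  have BA2 : B \subset ~: A2 by rewrite -setCS setCK.
  have AB : A1 \subset B by rewrite BE (subset_trans A1A) ?subsetUr.
  have E := aF _ _ A1F A2F (subset_trans AB BA2).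
  have := subset_leq_card A1A; have := subset_leq_card BA2; rewrite -E.
  have := cardsC B; lia.
rewrite card_co_family in UD.
have split_F : #|F| = #|[set A in F | #|A| <= k]| +
                      #|[set A in co_family F | #|A| <= k.-1]|.
  rewrite -(card_co_family [set A in co_family F | _]).
  rewrite -(cardsID [set A : {set T} | #|A| <= k] F); congr (_ + _).
    by apply: eq_card => A; rewrite !inE.
  apply: eq_card => A; rewrite co_familyE !inE co_familyE setCK cC andbC.
  by congr (_ && _); have := max_card A; lia.
rewrite split_F; apply: leq_trans UD; case/orP: sA0 => sA0.
  have {}lo : #|[set A in F | #|A| <= k]| + (#|T| - k) <= #|U|.
    by apply: lo; exists A0.
  rewrite addnAC leq_add // (leq_trans _ U_up) // (leq_trans _ lo) //.
  by rewrite leq_add2l; lia.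
have {}hi : #|[set A in co_family F | #|A| <= k.-1]| + (#|T| - k.-1) <= #|D|.
  apply: hi; exists (~: A0); first by rewrite co_familyE setCK.
  have := max_card A0; rewrite cC; lia.
rewrite -addnA leq_add // ?(leq_trans loge) // (leq_trans _ hi) // leq_add2l; lia.
Qed.

(** Let [D] be the lower shadow of the [k + 1]-sets of [F]; it is at least as
    large as they are and disjoint from the [k]-sets of [F].  Every set of the
    resulting family [G] on level [k] lies inside a member of [F], so a
    complementary pair in [G] would give two members covering everything. *)
Lemma middle_levels (T : finType) (k : nat) (F : {set {set T}}) :
  #|T| = k.*2 -> antichain F ->
  (forall A, A \in F -> k <= #|A| <= k.+1) ->
  (forall A B, A \in F -> B \in F -> A :|: B != setT) ->
  #|F|.*2 <= 'C(k.*2, k).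
Proof.
move=> cT aF sF uF.
pose Fk := [set A in F | #|A| == k]; pose Fk1 := [set A in F | #|A| == k.+1].
pose D := co_family (upshadow setT (co_family Fk1)).
have DP B : B \in D ->
    exists v A, [/\ A \in F, v \notin B, #|A| = k.+1 & A = v |: B].
  rewrite co_familyE => /upshadowP[A [v [AF /setDP[_ vA] BE]]].
  move: AF; rewrite co_familyE => /setIdP[AF /eqP cA].
  exists v, (~: A); split=> //; first by rewrite -in_setC BE !inE eqxx.
  rewrite -[B]setCK BE setCU; apply/setP => x; rewrite !inE.
  by case: eqP => [->|] //=; rewrite (negPf vA).
have cF : #|F| = #|Fk| + #|Fk1|.
  rewrite -cardsUI [X in _ = _ + X](_ : _ = 0) ?addn0.
    apply: eq_card => A; rewrite !inE -andb_orr.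
    case AF: (A \in F) => //=; have := sF _ AF; lia.
  by apply: eq_card0 => A; rewrite !inE; lia.
have Fk1D : #|Fk1| <= #|D|.
  rewrite /D card_co_family -(card_co_family Fk1).
  apply: (@upshadow_ge _ set0 _ k.-1 k.+1); last lia.
  move=> A; rewrite co_familyE => /setIdP[_ /eqP cA].
  rewrite sub0set subsetT setD0 setTD; split=> //.
  by have := cardsC A; lia.
have FkD : [disjoint Fk & D].
  apply/pred0P => A /=; apply/negP => /andP[/setIdP[AF /eqP cA]].
  move=> /DP[v [B [BF vA cB BE]]].
  have := aF _ _ AF BF; rewrite BE subsetUr -BE => /(_ isT) E.
  by move: cB; rewrite -E cA; lia.
pose G := Fk :|: D.
have cG : #|F| <= #|G|.
  by rewrite /G cardsU disjoint_setI0 // cards0 subn0 cF leq_add2l.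
have Gk A : A \in G -> #|A| = k.
  rewrite inE => /orP[/setIdP[_ /eqP]//|/DP[v [B [BF vA cB BE]]]].
  by move: cB; rewrite BE cardsU1 vA => -[].
have Gsub A : A \in G -> exists2 B, B \in F & A \subset B.
  rewrite inE => /orP[/setIdP[AF _]|/DP[v [B [BF vA cB BE]]]]; first by exists A.
  by exists B; rewrite // BE subsetUr.
have dis : [disjoint G & co_family G].
  apply/pred0P => A /=; apply/negP => /andP[/Gsub[B BF AB]].
  rewrite co_familyE => /Gsub[B' B'F AB'].
  case/negP: (uF _ _ BF B'F); rewrite eqEsubset subsetT -(setUCr A).
  exact: setUSS.
rewrite -addnn; apply: leq_trans (leq_add cG cG) _.
rewrite -{2}(card_co_family G) -cardsUI disjoint_setI0 // cards0 addn0.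
rewrite -cT -card_draws; apply/subset_leq_card/subsetP => B.
rewrite in_setU => BU; rewrite inE; move: BU => /orP[/Gk->//|].
by rewrite co_familyE => /Gk cB; have := cardsC B; lia.
Qed.

(** By Pascal's rule the two sides differ by twice ['C(2k - 1, k + 1)], less
    [2k], and a binomial coefficient away from both ends of its row is at least
    the row index. *)
Lemma bin_middle_gap (k : nat) :
  2 < k -> 'C(k.*2, k) + k.*2 <= 'C(k.*2, k.+1).*2.
Proof.
move=> k2.
have low j N : 0 < j < N -> N <= 'C(N, j).
  elim: N j => [|N IH] [|j] //= jN.
  rewrite binS; have [jN'|Nj] := ltnP j.+1 N.
    have := IH j.+1 jN'; have : 0 < 'C(N, j) by rewrite bin_gt0; lia.
    by lia.
  have -> : N = j.+1 by lia.
  by rewrite binn binSn; lia.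
have E : k.*2 = (k.*2.-1).+1 by lia.
have S1 : 'C(k.*2, k) = 'C(k.*2.-1, k) + 'C(k.*2.-1, k.-1)
  by rewrite [in LHS]E; case: (k) k2 => // ? _; rewrite binS.
have S2 : 'C(k.*2, k.+1) = 'C(k.*2.-1, k.+1) + 'C(k.*2.-1, k)
  by rewrite [in LHS]E; case: (k) k2 => // ? _; rewrite binS.
have S3 : 'C(k.*2.-1, k) = 'C(k.*2.-1, k.-1).
  by rewrite -bin_sub; [congr 'C(_, _)|]; lia.
have := low k.+1 k.*2.-1; lia.
Qed.

(** * Difference sets of a code *)

Definition differ (n : nat) (Q : finType) (x y : {ffun 'I_n -> Q}) :=
  [set i | x i != y i].

(** Otherwise [z] would agree with [x] and [y] wherever these agree, so it would
    be a third codeword descending from the pair. *)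
Lemma wFP_separates (n : nat) (Q : finType) (C : {set {ffun 'I_n -> Q}})
    (x y z : {ffun 'I_n -> Q}) : wide_frameproof 2 C ->
  x \in C -> y \in C -> z \in C -> z != x -> z != y ->
  exists2 i, x i = y i & z i != x i.
Proof.
move=> wC xC yC zC zx zy.
have /setP/(_ z) : wdesc [set x; y] :&: C = [set x; y].
  apply: wC; first by apply/set0Pn; exists x; rewrite !inE eqxx.
    by rewrite subUset !sub1set xC.
  by rewrite cards2; case: (_ != _).
rewrite in_setI zC andbT !inE (negPf zx) (negPf zy) /= => /negbT.
rewrite negb_forall_in => /exists_inP[i].
rewrite inE => /forall_inP H; rewrite negb_forall_in => /exists_inP[w wX zw].
have agree u v : u \in [set x; y] -> v \in [set x; y] -> u i = v i.
  by move=> uX vX; apply/eqP; move/forall_inP: (H u uX); apply.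
exists i; first by apply: agree; rewrite !inE eqxx ?orbT.
by rewrite (agree x w) // !inE eqxx.
Qed.

Definition differ_family (n : nat) (Q : finType) (C : {set {ffun 'I_n -> Q}})
    (x : {ffun 'I_n -> Q}) := [set differ x y | y in C :\ x].

Lemma differ_sub_inj (n : nat) (Q : finType) (C : {set {ffun 'I_n -> Q}})
    (x y z : {ffun 'I_n -> Q}) : wide_frameproof 2 C -> x \in C ->
  y \in C :\ x -> z \in C :\ x -> differ x y \subset differ x z -> y = z.
Proof.
move=> wC xC /setD1P[yx yC] /setD1P[zx zC] yz; apply/eqP/negPn/negP => nyz.
have [i xz yi] := wFP_separates wC xC zC yC yx nyz.
by have/subsetP/(_ i) := yz; rewrite !inE xz eqxx -xz eq_sym yi => /(_ isT).
Qed.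

Lemma card_differ_family (n : nat) (Q : finType) (C : {set {ffun 'I_n -> Q}})
    (x : {ffun 'I_n -> Q}) : wide_frameproof 2 C -> x \in C ->
  #|C| = #|differ_family C x|.+1.
Proof.
move=> wC xC; rewrite (cardsD1 x) xC card_in_imset // => y z yC zC E.
by apply: (differ_sub_inj wC xC yC zC); rewrite E.
Qed.

Lemma antichain_differ (n : nat) (Q : finType) (C : {set {ffun 'I_n -> Q}})
    (x : {ffun 'I_n -> Q}) : wide_frameproof 2 C -> x \in C ->
  antichain (differ_family C x).
Proof.
move=> wC xC _ _ /imsetP[y yC ->] /imsetP[z zC ->].
by move/(differ_sub_inj wC xC yC zC)->.
Qed.

Lemma intersecting_differ (n : nat) (Q : finType) (C : {set {ffun 'I_n -> Q}})
    (x : {ffun 'I_n -> Q}) : wide_frameproof 2 C -> x \in C ->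
  intersecting (differ_family C x).
Proof.
move=> wC xC _ _ /imsetP[y /setD1P[yx yC] ->] /imsetP[z /setD1P[zx zC] ->].
rewrite eq_sym in yx; rewrite eq_sym in zx.
have [i yz xi] := wFP_separates wC yC zC xC yx zx.
by apply/set0Pn; exists i; rewrite !inE -yz xi.
Qed.

(** Where [y] and [z] agree, they differ from [x] both or not at all, and the
    covering excludes the latter. *)
Lemma differ_cover (n : nat) (Q : finType)
    (x y z : {ffun 'I_n -> Q}) : differ x y :|: differ x z = setT ->
  ~: differ y z \subset differ x y :&: differ x z.
Proof.
move=> cov; apply/subsetP => i; rewrite !inE negbK => /eqP yz.
by have/setP/(_ i) := cov; rewrite !inE yz orbb => ->.
Qed.

Lemma wFP_far_pair (n k : nat) (Q : finType) (C : {set {ffun 'I_n -> Q}})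
    (x y : {ffun 'I_n -> Q}) :
  n = k.*2 -> 0 < k -> wide_frameproof 2 C -> x \in C -> y \in C -> y != x ->
  (#|differ x y| < k) || (k.+1 < #|differ x y|) ->
  #|C| + k <= 'C(n, k.+1) + 1.
Proof.
move=> nk k0 wC xC yC yx far.
rewrite (card_differ_family wC xC) addSn addn1 ltnS [X in 'C(X, _)]nk.
apply: milner_gain; rewrite ?card_ord //.
- exact: antichain_differ.
- exact: intersecting_differ.
- by exists (differ x y) => //; apply/imsetP; exists y; rewrite // !inE yx.
Qed.

Lemma wFP_bound (n k : nat) (Q : finType) (C : {set {ffun 'I_n -> Q}}) :
  n = k.*2 -> 3 < k -> wide_frameproof 2 C -> C != set0 ->
  #|C| + k <= 'C(n, k.+1) + 1.
Proof.
move=> nk k3 wC /set0Pn[x xC].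
have k0 : 0 < k by lia.
have [/exists_inP[y /setD1P[yx yC] far]|near] := boolP [exists y in C :\ x,
    (#|differ x y| < k) || (k.+1 < #|differ x y|)].
  exact: (wFP_far_pair nk k0 wC xC yC yx far).
have size_le y : y \in C :\ x -> k <= #|differ x y| <= k.+1.
  move=> yC; move: near; rewrite negb_exists_in => /forall_inP/(_ y yC).
  by rewrite negb_or -!leqNgt.
have [/exists_inP[y yC /exists_inP[z zC /eqP cov]]|nocov] :=
  boolP [exists y in C :\ x, exists z in C :\ x,
           differ x y :|: differ x z == setT].
  (* The overlap of the two covering sets has size at most
     [2 * (k + 1) - 2 * k = 2], so the distance of [y] and [z] is at least
     [2 * k - 2], which exceeds [k + 1] exactly because [3 < k]. *)
  have overlap := subset_leq_card (differ_cover cov).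
  have := cardsUI (differ x y) (differ x z); rewrite cov cardsT card_ord => cUI.
  have [/andP[_ sy] /andP[_ sz]] := (size_le y yC, size_le z zC).
  have := cardsC (differ y z); rewrite card_ord => cyz.
  have far : k.+1 < #|differ y z| by lia.
  have zy : z != y.
    apply: contraTneq far => ->; rewrite -leqNgt /differ.
    rewrite (_ : finset _ = set0) ?cards0 //.
    by apply/setP => i; rewrite !inE eqxx.
  move: yC zC => /setD1P[_ yC] /setD1P[_ zC].
  by apply: (wFP_far_pair nk k0 wC yC zC zy); rewrite far orbT.
have half : #|differ_family C x|.*2 <= 'C(k.*2, k).
  apply: middle_levels; rewrite ?card_ord //.
  - exact: antichain_differ.
  - by move=> _ /imsetP[y yC ->]; apply: size_le.
  - move=> _ _ /imsetP[y yC ->] /imsetP[z zC ->]; apply: contraNN nocov => cov.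
    by apply/exists_inP; exists y => //; apply/exists_inP; exists z.
have gap : 'C(k.*2, k) + k.*2 <= 'C(k.*2, k.+1).*2.
  by apply: bin_middle_gap; lia.
rewrite (card_differ_family wC xC) addSn addn1 ltnS [X in 'C(X, _)]nk.
rewrite -leq_double doubleD.
by rewrite (leq_trans _ gap) // leq_add2r.
Qed.

Unset Implicit Arguments.

Theorem theorem3p2 (n m q : nat) (Q : finType) (C : {set {ffun 'I_n -> Q}})
    (n_even : ~~ odd n) (n_ge8 : 8 <= n)
    (C_code : is_code m q C) (C_wFP : wide_frameproof 2 C) :
  m <= 'C(n, n %/ 2 - 1) - n %/ 2 + 1.
Proof.
case: C_code => _ <-.
pose k := n %/ 2.
have nk : n = k.*2 by rewrite /k divn2 even_halfK.
have k3 : 3 < k by lia.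
have binE : 'C(n, k - 1) = 'C(n, k.+1).
  by rewrite -bin_sub; [congr 'C(_, _)|]; lia.
rewrite -/k binE.
have [->|C0] := eqVneq C set0; first by rewrite cards0.
have := wFP_bound nk k3 C_wFP C0; lia.
Qed.
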